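(* Let $D=K_1\cup K_2\cup\dots\cup K_r$ and $D'=K'_1\cup K'_2\cup\dots\cup K'_r$ be diagrams of the same unoriented ordered link. Any sequence of Reidemeister moves that transforms $D$ into $D'$ must contain at least $$\frac12\sum_{i=1}^r|\Phi(K'_i)-\Phi(K_i)|$$ Reidemeister moves of type R$\mathrm{III}\alpha$.
   Context: An $r$-component link is an embedding of $r$ circles in $S^3$ or $\mathbb{R}^3$. A diagram $D=K_1\cup\dots\cup K_r$ of a link $k_1\cup\dots\cup k_r$ is a regular projection onto $S^2$ or $\mathbb{R}^2$ (with $K_i$ the image of $k_i$) whose intersections are transverse double points with over/under information. RI, RII, RIII denote the usual three types of Reidemeister moves. For ordered links the components are distinguished: a sequence of moves transforming $D$ into $D'$ carries $K_i$ to $K'_i$ for each $i$. A crossing is non-self if its two strands belong to different components. For an oriented diagram, the non-self OU sequence $f(K_i)$ is the cyclic sequence obtained by traversing $K_i$ once along its orientation and recording, only at the non-self crossings encountered, $O$ when passing over and $U$ when passing under. It is empty if $K_i$ has no non-self crossings. Its length is always even. For a non-cyclic sequence $S=X_1X_2\cdots X_m$ with $X_i\in\{O,U\}$, put $\varepsilon(X_i)=+1$ if ($X_i=O$ and $i$ even) or ($X_i=U$ and $i$ odd), and $\varepsilon(X_i)=-1$ otherwise; $\Phi(S)=\frac12\sum_{i=1}^m\varepsilon(X_i)$. For a cyclic sequence $w$ of even length, $\Phi(w)=|\Phi(S)|$, where $S$ is any non-cyclic sequence obtained by cutting $w$ open (this is independent of the cut). The OU number of $K_i$ is $\Phi(K_i)=\Phi(f(K_i))$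 (so $\Phi(K_i)=0$ if $f(K_i)$ is empty). It does not depend on the orientations, so it is also defined for unoriented diagrams. The three segments in an RIII move are: the upper segment (over the other two), the middle segment (under the upper and over the lower), and the lower segment (under the other two). An RIII move is an R$\mathrm{III}\alpha$ move if the upper and middle segments belong to different components and the middle and lower segments belong to different components (the upper and lower segments may belong to the same or different components). *)

(* Defs.v *)
From HB Require Import structures.
From mathcomp Require Import all_boot all_order all_fingroup all_algebra.

Set Implicit Arguments.
Unset Strict Implicit.
Unset Printing Implicit Defensive.

Import Order.TTheory GRing.Theory Num.Theory.

(* A link diagram on S^2 or R^2, up to planar isotopy, is a decorated
   combinatorial map.  The vertices are the crossings (4 half-edges) and
   auxiliary marked points on the strands (2 half-edges).  Marked points carry
   no information: planar isotopy may insert and delete them.  They provide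
   crossingless circles with half-edges and let a Reidemeister move be described
   at the places where it is performed.

   - dart: half-edges, each thought of as pointing away from its vertex;
   - node: the next half-edge counterclockwise around the same vertex;
   - edge: the other half of the same edge;
   - over: whether the strand of the half-edge passes over at its vertex
     (false at marked points);
   - comp: the index i of the component K_i carrying the half-edge;
   - region, reg: the complementary regions, and the region to the left of a
     half-edge.  Diagrams may be disconnected, so a region may have several
     boundary circles;
   - infinity: None for a diagram on S^2; for a diagram on R^2, the region of
     S^2 = R^2 + {oo} that contains oo. *)
Record map_data (r : nat) := MapData {
  dart : finType;
  node : {perm dart};
  edge : {perm dart};
  over : dart -> bool;
  comp : dart -> 'I_r;
  region : finType;
  reg : dart -> region;
  infinity : option region
}.

Section MapData.
Variables (r : nat) (D : map_data r).
Implicit Types d e : dart D.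

Definition crossing d : bool := #|porbit (node D) d| == 4.
Definition marked_point d : bool := #|porbit (node D) d| == 2.

(* The half-edge along which a strand arriving at a vertex along d leaves. *)
Definition opp d : dart D :=
  if crossing d then node D (node D d) else node D d.

(* The orbits of face are the boundary circles of the regions, traversed with
   the region on the left: face D d = (node D)^-1 (edge D d). *)
Definition face : {perm dart D} := (edge D * (node D)^-1)%g.

(* Gluing to the graph, for every region, a sphere with as many holes as the
   region has boundary circles gives a closed oriented surface.  It has Euler
   characteristic V - E + \sum_R (2 - b_R) = V - E + 2 #R - #faces, so it is a
   sphere iff it is connected and this number is 2. *)
Definition spherical : Prop :=
  [/\ forall d, reg (face d) = reg d,
      forall R : region D, exists d, reg d = R,
      forall d e,
        connect [rel a b | [|| b == node D a, b == edge D a | reg b == reg a]]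
                d e
    & (#|porbits (node D)| + 2 * #|region D|
         = #|porbits (edge D)| + #|porbits face| + 2)%N].

Definition diagram_axiom : Prop :=
  [/\ forall d, crossing d || marked_point d,
      forall d, edge D (edge D d) = d /\ edge D d != d,
      (* strands alternate around a crossing; over is false at marked points *)
      forall d, over (node D d) = crossing d && ~~ over d,
      (* the components are K_0, ..., K_(r-1), each a single closed curve *)
      (forall d e, connect [rel a b | (b == edge D a) || (b == opp a)] d e
                   = (comp d == comp e))
        /\ (forall i : 'I_r, exists d, comp d = i)
    & spherical].

End MapData.

Record diagram (r : nat) := Diagram {
  diagram_map :> map_data r;
  diagram_ok : diagram_axiom diagram_map
}.

Section OUNumber.
Variable r : nat.
Implicit Type D : diagram r.

Definition travel D (d : dart D) : dart D := opp (edge D d).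

Definition nonself D (d : dart D) : bool :=
  crossing d && (comp (node D d) != comp d).

(* The non-self OU sequence of the component through d, cut open at d and
   traversed in the direction of d; true stands for O and false for U. *)
Definition OU_seq D (d : dart D) : seq bool :=
  [seq over e | e <- fingraph.orbit (@travel D) d & nonself e].

Local Open Scope ring_scope.

(* eps i X is the sign of the letter X in the i-th place, i starting from 1. *)
Definition eps (i : nat) (X : bool) : rat :=
  if (X && ~~ odd i) || (~~ X && odd i) then 1 else -1.

Definition Phi (S : seq bool) : rat :=
  2%:R^-1 * \sum_(j < size S) eps j.+1 (nth false S j).

(* Every component has half-edges, so [pick] always succeeds; the value depends
   neither on the starting point nor on the direction of the one it picks. *)
Definition OU_number D (i : 'I_r) : rat :=
  if [pick d : dart D | comp d == i] is Some d then `|Phi (OU_seq d)| else 0.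

End OUNumber.

Section Moves.
Variables (r : nat) (D D' : diagram r).
Implicit Type f : dart D -> dart D'.

(* D' has the half-edges of D, embedded by f, and the new ones listed in N.  The
   vertices of the half-edges in A and the edges of those in B may change. *)
Definition agree_off f (N : seq (dart D')) (A B : pred (dart D)) : Prop :=
  [/\ injective f,
      uniq N /\ (forall d', (d' \in codom f) = (d' \notin N)),
      forall d, comp (f d) = comp d,
      forall d, ~~ A d -> node D' (f d) = f (node D d) /\ over (f d) = over d
    & forall d, ~~ B d -> edge D' (f d) = f (edge D d)].

Definition same_regions f : Prop :=
  forall d e, (reg (f d) == reg (f e)) = (reg d == reg e).

(* Stated so as to allow the region of d to be cut into several ones. *)
Definition same_infinity f : Prop :=
  forall d, infinity D = Some (reg d) <->
    exists2 e, reg e = reg d & infinity D' = Some (reg (f e)).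

Definition isotopic : Prop :=
  exists f, [/\ agree_off f [::] pred0 pred0, same_regions f & same_infinity f].

(* Insertion of a marked point, with half-edges u and v, on the edge of x. *)
Definition subdivision : Prop :=
  exists f (x : dart D) (u v : dart D'),
    [/\ agree_off f [:: u; v] pred0 (pred2 x (edge D x)),
        edge D' (f x) = u /\ edge D' (f (edge D x)) = v,
        node D' u = v /\ node D' v = u,
        same_regions f & same_infinity f].

(* A marked point with half-edges x, y becomes a crossing with a loop uv:
   counterclockwise around the crossing one finds x, y, u, v.  The loop lies to
   the left or to the right of the strand according to which of its two
   half-edges is called x. *)
Definition RI_move : Prop :=
  exists f (x y : dart D) (u v : dart D'),
    [/\ marked_point x /\ node D x = y,
        agree_off f [:: u; v] (pred2 x y) pred0,
        [/\ node D' (f x) = f y, node D' (f y) = u,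
            node D' u = v & node D' v = f x]
          /\ edge D' u = v,
        (* the loop bounds an empty disc *)
        (forall d', reg d' = reg u -> d' = u) /\ infinity D' <> Some (reg u)
      & same_regions f /\ same_infinity f].

(* Two strands, x to y and z to w, are marked at points on the boundary of a
   common region lying to the left of x and of w (x and z point to the west, y
   and w to the east, xy runs north of zw).  A finger of one strand is pushed
   across the other one, which gives a west crossing, with half-edges x, z, u, s
   in counterclockwise order, and an east crossing, with half-edges y, t, v, w
   in counterclockwise order, joined by the two edges uv and st.
   The region between the strands is cut into the one to the left of x and the
   one to the left of w; these still coincide iff the strands lay on different
   boundary circles of the region. *)
Definition RII_move : Prop :=
  exists f (x y z w : dart D) (u v s t : dart D'),
    [/\ [/\ marked_point x, marked_point z, node D x = y, node D z = w
          & uniq [:: x; y; z; w]]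
          /\ agree_off f [:: u; v; s; t] (mem [:: x; y; z; w]) pred0,
        [/\ node D' (f x) = f z, node D' (f z) = u,
            node D' u = s & node D' s = f x]
          /\ [/\ node D' (f y) = t, node D' t = v,
            node D' v = f w & node D' (f w) = f y],
        [/\ edge D' u = v, edge D' s = t & over (f x) = over (f y)],
        (* the bigon is an empty disc *)
        (forall d', reg d' = reg u -> d' \in [:: u; t])
          /\ infinity D' <> Some (reg u)
      & (forall d e, (reg d == reg e) =
           (reg (f d) == reg (f e))
           || (reg (f d) \in [:: reg (f x); reg (f w)])
              && (reg (f e) \in [:: reg (f x); reg (f w)]))
        /\ same_infinity f].

End Moves.

Section TriangleMove.
Variables (r : nat) (D : diagram r).
Implicit Types u m l d : dart D.

(* The sides of u, m and l bound an empty triangle, which is to their left, with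
   three distinct crossings as corners; they are the parts inside the disc of
   the move of the upper, the middle and the lower segment. *)
Definition RIII_triangle u m l : Prop :=
  [/\ porbit (face D) u = [set u; m; l],
      all (@crossing r D) [:: u; m; l]
        /\ uniq [seq porbit (node D) d | d <- [:: u; m; l]],
      over u /\ over (edge D u),
      ~~ over l /\ ~~ over (edge D l)
    & (forall d, reg d = reg u -> d \in [:: u; m; l])
        /\ infinity D <> Some (reg u)].

Definition triangle_side u m l d : bool :=
  (d \in [:: u; m; l]) || (edge D d \in [:: u; m; l]).

(* On each segment  -p-[c]-q---q'-[c']-p'-  the move exchanges the crossings c
   and c', keeping their half-edges and the directions of these: the new
   connections are  -q'-[c']-p'---p-[c]-q- .  So q' takes the place of p, p' the
   place of q, and conversely. *)
Definition RIII_swap u m l d : dart D :=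
  if triangle_side u m l d then opp (edge D d)
  else if triangle_side u m l (opp d) then edge D (opp d)
  else d.

Definition RIII_alpha u m l : bool :=
  (comp u != comp m) && (comp m != comp l).

End TriangleMove.

Definition RIII_move (r : nat) (alpha : bool) (D D' : diagram r) : Prop :=
  exists (f : dart D -> dart D') (u m l : dart D),
    let swap := RIII_swap u m l in
    [/\ RIII_triangle u m l /\ RIII_alpha u m l = alpha,
        agree_off f [::] pred0 predT,
        forall d, edge D' (f (swap d)) = f (swap (edge D d)),
        (* the new triangle is to the left of opp u, and is empty *)
        (forall d', reg d' = reg (f (opp u)) ->
                    d' \in porbit (face D') (f (opp u)))
          /\ infinity D' <> Some (reg (f (opp u)))
      & (* the regions outside the disc of the move are unchanged *)
        (forall d e, ~~ triangle_side u m l d -> ~~ triangle_side u m l e ->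
           (reg (f (swap d)) == reg (f (swap e))) = (reg d == reg e))
        /\ (forall d, ~~ triangle_side u m l d ->
           infinity D' = Some (reg (f (swap d))) <-> infinity D = Some (reg d))].

Inductive move_kind :=
  | Isotopy
  | RI
  | RII
  | RIII of bool (* RIII true is RIII alpha, RIII false any other RIII *).

Definition is_RIIIalpha (k : move_kind) : bool :=
  if k is RIII true then true else false.

Definition move (r : nat) (k : move_kind) (D D' : diagram r) : Prop :=
  match k with
  | Isotopy => isotopic D D' \/ subdivision D D'
  | RI => RI_move D D'
  | RII => RII_move D D'
  | RIII alpha => RIII_move alpha D D'
  end.

Definition step (r : nat) (k : move_kind) (D D' : diagram r) : Prop :=
  move k D D' \/ move k D' D.

Fixpoint transforms (r : nat) (s : seq move_kind) (D D' : diagram r) : Prop :=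
  if s is k :: s' then exists2 D1, step k D D1 & transforms s' D1 D'
  else D = D'.

(* Main.v *)
From mathcomp Require Import all_boot all_order all_fingroup all_algebra.
From mathcomp Require Import zify ring lra.
Require Import Defs.

Set Implicit Arguments.
Unset Strict Implicit.
Unset Printing Implicit Defensive.

Import Order.TTheory GRing.Theory Num.Theory.
Local Open Scope ring_scope.

(** An OU number can be computed without following a strand.  Call a sign on the
half-edges alternating if it changes along every edge, and changes along every
strand through a vertex except where the strand passes a non-self crossing: there
its two half-edges get the same sign.  Travelling along K_i, the sign of the
half-edge by which one leaves a vertex changes exactly at the non-self crossings,
as the parity of the place in the OU sequence does.  So the sum over the non-self
half-edges of K_i of this sign times +1 or -1, according to whether the strand is
over or under, is 4 Phi(K_i) up to sign, each passage being counted at both of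
its half-edges and Phi having a factor 1/2 ([weight_OU]).

An alternating sign exists on every diagram ([ex_alternating]); this expresses
that every component has an even number of non-self crossings, and it is the only
place where planarity enters.  The union of the components other than K_i is a
cycle modulo 2.  As the first homology of the sphere vanishes ([cycle_bounds]),
the faces have a 2-colouring that changes precisely across this cycle
([mod2_coloring]).  Along K_i the colour on the left changes precisely at the
non-self crossings, and the product of this colour and of an orientation of K_i
is an alternating sign.

An alternating sign is a local datum, hence easily carried through a move.  For
isotopies, RI and RII, one on the larger diagram restricts to the smaller one;
what is forgotten consists of vertices that are not non-self crossings, or cancels
along the two sides of the bigon of RII ([OU_number_embedding]).  For RIII, an
alternating sign remains so after the move if it is reversed at each passage of a
segment through a corner of the triangle whose other corner on that segment is
non-self ([flipped_swap]).  On the upper and on the lower segment the two passages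
have the same letter and opposite signs, so the two reversals compensate.  The
middle segment contributes a change of at most 8, and only if both its corners are
non-self, that is, if the move is of type alpha.  So a move of type alpha changes
one OU number, by at most 2, and no other move changes any; the theorem follows by
the triangle inequality. *)

(** * Vanishing of the first homology of the sphere modulo 2 *)

Lemma F2_addrr (x : 'F_2) : x + x = 0.
Proof. by rewrite -mulr2n -mulr_natr (pchar_Fp_0 (isT : prime 2)) mulr0. Qed.

Section Functions.
Variable T : finType.
Implicit Types v w : 'rV['F_2]_#|T|.

Definition row_of (h : T -> 'F_2) : 'rV['F_2]_#|T| := \row_j h (enum_val j).
Definition at_pt v (x : T) : 'F_2 := v 0 (enum_rank x).

Lemma at_row_of h x : at_pt (row_of h) x = h x.
Proof. by rewrite /at_pt mxE enum_rankK. Qed.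

Lemma at_inj v w : at_pt v =1 at_pt w -> v = w.
Proof.
by move=> vw; apply/rowP=> j; have := vw (enum_val j); rewrite /at_pt enum_valK.
Qed.

(** The row space consists of the functions that factor through [k]. *)
Definition level_mx (K : finType) (k : T -> K) : 'M['F_2]_(#|k @: T|, #|T|) :=
  \matrix_(i, j) (k (enum_val j) == enum_val i)%:R.

(** A section of [k] gives both the independence of the rows and the
coordinates of a vector that factors through [k]. *)
Lemma level_mx_section (K : finType) (k : T -> K) :
  exists g : 'I_#|k @: T| -> 'I_#|T|, forall i, k (enum_val (g i)) = enum_val i.
Proof.
apply: (@fin_all_exists _ _ (fun i j => k (enum_val j) = enum_val i)) => i.
have /imsetP[x _ Dx] := enum_valP i.
by exists (enum_rank x); rewrite enum_rankK.
Qed.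

Lemma rank_level_mx (K : finType) (k : T -> K) :
  \rank (level_mx k) = #|k @: T|.
Proof.
have [g gP] := level_mx_section k.
apply/eqP/row_freeP; exists (\matrix_(j, i) (j == g i)%:R).
apply/matrixP=> i i'; rewrite !mxE (bigD1 (g i')) //= big1 ?addr0 => [|j ne].
  by rewrite !mxE eqxx mulr1 gP (inj_eq enum_val_inj) eq_sym.
by rewrite !mxE (negPf ne) mulr0.
Qed.

Lemma rank_orbit_mx (p : {perm T}) : \rank (level_mx (porbit p)) = #|porbits p|.
Proof. exact: rank_level_mx. Qed.

Lemma sub_level_mxP (K : finType) (k : T -> K) v :
  reflect (forall x y, k x = k y -> at_pt v x = at_pt v y)
          (v <= level_mx k)%MS.
Proof.
apply: (iffP idP) => [/submxP[a ->] x y kxy | vk].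
  rewrite /at_pt !mxE; apply: eq_bigr => i _.
  by rewrite !mxE !enum_rankK kxy.
have [g gP] := level_mx_section k.
apply/submxP; exists (\row_i v 0 (g i)); apply: at_inj => x.
have kx : k x \in k @: T by apply: imset_f.
rewrite [RHS]mxE (bigD1 (enum_rank_in kx (k x))) //= big1 ?addr0 => [|i ne].
  rewrite !mxE !enum_rankK enum_rankK_in // eqxx mulr1.
  rewrite -[g _]enum_valK; apply: vk.
  by rewrite gP enum_rankK_in.
rewrite !mxE enum_rankK; case: eqP => [kxi|]; last by rewrite mulr0.
by case/negP: ne; apply/eqP/enum_val_inj; rewrite enum_rankK_in.
Qed.

Lemma sub_orbit_mxP (p : {perm T}) v :
  reflect (forall x, at_pt v (p x) = at_pt v x) (v <= level_mx (porbit p))%MS.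
Proof.
apply: (iffP (sub_level_mxP _ _)) => [vp x | vp x y].
  by apply: vp; apply/eqP; rewrite eq_porbit_mem (mem_porbit p 1).
move/eqP; rewrite eq_porbit_mem => /porbitP[i ->].
by elim: i => [|i IHi]; rewrite ?perm1 // expgSr permM vp.
Qed.

Lemma dotmx_sum v w : v *m w^T = (\sum_x at_pt v x * at_pt w x)%:M.
Proof.
rewrite [LHS]mx11_scalar mxE; congr _%:M.
rewrite (reindex_onto (@enum_rank T) enum_val) /= => [|j _]; last exact: enum_valK.
by apply: eq_big => [x|x _]; rewrite ?enum_rankK ?eqxx // mxE.
Qed.

Lemma orthogonal_rows m (A : 'M['F_2]_(m, #|T|)) v :
  (forall w, (w <= A)%MS -> \sum_x at_pt v x * at_pt w x = 0) -> v *m A^T = 0.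
Proof.
move=> vA; apply/trmx_inj; rewrite trmx_mul trmxK trmx0.
apply/row_matrixP=> i; rewrite row_mul row0; apply/trmx_inj.
by rewrite trmx_mul trmxK trmx0 dotmx_sum vA ?row_sub // raddf0.
Qed.

(** The terms cancel in pairs modulo 2; the enumeration of [T] selects one element
of each pair. *)
Lemma sum_involution_F2 (g : T -> T) (h : T -> 'F_2) :
    involutive g -> (forall x, g x != x) -> (forall x, h (g x) = h x) ->
  \sum_x h x = 0.
Proof.
move=> gK gx hg.
rewrite (bigID (fun x => enum_rank x < enum_rank (g x))%N) /=.
rewrite [X in _ + X](reindex_inj (inv_inj gK)) /=.
rewrite [X in _ + X](eq_bigl (fun x => enum_rank x < enum_rank (g x))%N).
  by under [X in _ + X]eq_bigr do rewrite hg; rewrite F2_addrr.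
move=> x; rewrite gK -leqNgt leq_eqVlt (inj_eq (@ord_inj _)).
by rewrite (inj_eq enum_rank_inj) eq_sym (negPf (gx x)).
Qed.

End Functions.

(** The dimension count for [cycle_bounds].  Here [n], [V], [E], [F], [R] are the
numbers of half-edges, vertices, edges, faces and regions, [x] is the number of
connected components of the graph, [n - sNE] is the dimension of the cycles
and [B] that of the boundaries.  The last two bounds give [R + x <= F + 1],
and the number [E - V + x = 2R + x - F - 2] is then at most [F - x]. *)
Lemma rank_count (n V E F R sNE x B k sGX y : nat) :
    (V + 2 * R = E + F + 2 -> n <= 2 * E ->
     sNE + x = V + E -> B + k = F -> sGX + y = R + x ->
     k <= x -> sGX <= F -> y <= 1 -> n - sNE <= B)%N.
Proof. lia. Qed.

Section Bounding.
Variables (T Rg : finType) (node edge : {perm T}) (reg : T -> Rg).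
Let face : {perm T} := (edge * node^-1)%g.

Hypothesis edgeK : involutive edge.
Hypothesis reg_face : forall d, reg (face d) = reg d.
Hypothesis reg_onto : forall R, exists d, reg d = R.
Hypothesis connected : forall d e,
  connect [rel a b | [|| b == node a, b == edge a | reg b == reg a]] d e.
Hypothesis euler : (#|porbits node| + 2 * #|Rg| = #|porbits edge| + #|porbits face| + 2)%N.

Let N := level_mx (porbit node).
Let E := level_mx (porbit edge).
Let F := level_mx (porbit face).
Let G := level_mx reg.

(** The boundary: a function on faces, viewed on half-edges by taking the face to
the left, is mapped to the difference of its values on both sides of an edge. *)
Definition bd_mx : 'M['F_2]_#|T| :=
  1%:M + \matrix_(i, j) (enum_val i == edge (enum_val j))%:R.

Lemma at_bd_mx v x : at_pt (v *m bd_mx) x = at_pt v x + at_pt v (edge x).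
Proof.
rewrite mulmxDr mulmx1 /at_pt [LHS]mxE; congr (_ + _).
rewrite mxE (bigD1 (enum_rank (edge x))) //= big1 ?addr0 => [|j ne].
  by rewrite mxE !enum_rankK eqxx mulr1.
rewrite mxE enum_rankK; case: eqP => [jx|]; last by rewrite mulr0.
by rewrite -jx enum_valK eqxx in ne.
Qed.

Lemma face_edge_node v : (v <= F)%MS -> forall x, at_pt v (edge (node x)) = at_pt v x.
Proof.
move=> /sub_orbit_mxP vF x; rewrite -vF /face permM edgeK.
by rewrite permK.
Qed.

(** Both the kernel and the image of [1 + edge] consist of functions on edges. *)
Lemma card_le_edges : (#|T| <= 2 * #|porbits edge|)%N.
Proof.
have := mxrank_ker bd_mx.
have bE: (bd_mx <= E)%MS.
  apply/row_subP=> i; rewrite rowE; apply/sub_orbit_mxP=> x.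
  by rewrite !at_bd_mx edgeK addrC.
have kE: (kermx bd_mx <= E)%MS.
  apply/row_subP=> i; apply/sub_orbit_mxP=> x; set v := row i _.
  have /eqP v0: v *m bd_mx == 0 by rewrite -sub_kermx row_sub.
  have: at_pt (v *m bd_mx) x = 0 by rewrite v0 /at_pt mxE.
  rewrite at_bd_mx => /eqP; rewrite addr_eq0 => /eqP->.
  by apply/eqP; rewrite -addr_eq0 F2_addrr.
have:= mxrankS bE; have := mxrankS kE; rewrite (rank_orbit_mx edge).
have := rank_leq_row bd_mx; lia.
Qed.

(** A cycle modulo 2 is a function orthogonal to all functions on vertices (its sum
around every vertex vanishes) and to all functions on edges (it takes the same
value on both halves of an edge).  The claim is that it is the boundary of a 2-colouring of the faces.  Boundaries are
cycles, so it suffices to compare dimensions.  Let X be the space of functions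
that are constant on the connected components of the graph.  Functions on
vertices and functions on edges meet in X, which gives the dimension of the
cycles; the boundary of a function on faces vanishes only if the function is in
X.  Regions allow the graph to be disconnected: functions on regions and X both
consist of functions on faces, and since everything together is connected they
meet only in the constants. *)
Lemma cycle_bounds (z : T -> 'F_2) :
    (forall v, (forall x, at_pt v (node x) = at_pt v x) ->
       \sum_x z x * at_pt v x = 0) ->
    (forall v, (forall x, at_pt v (edge x) = at_pt v x) ->
       \sum_x z x * at_pt v x = 0) ->
  exists c : T -> 'F_2, forall d, c (face d) = c d /\ c d + c (edge d) = z d.
Proof.
move=> zN zE; pose Z := kermx (col_mx N E)^T.
have subZ v: v *m N^T = 0 -> v *m E^T = 0 -> (v <= Z)%MS.
  by move=> vN vE; rewrite sub_kermx tr_col_mx mul_mx_row vN vE row_mx0.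
have BZ: (F *m bd_mx <= Z)%MS.
  apply/row_subP=> i; rewrite row_mul; set v := row i F.
  have vF: (v <= F)%MS by apply: row_sub.
  apply: subZ; apply: orthogonal_rows => w /sub_orbit_mxP wP.
    under eq_bigr do rewrite at_bd_mx mulrDl.
    rewrite big_split /= [X in _ + X](reindex_inj (@perm_inj _ node)) /=.
    by under [X in _ + X]eq_bigr do rewrite face_edge_node // wP; rewrite F2_addrr.
  under eq_bigr do rewrite at_bd_mx mulrDl.
  rewrite big_split /= [X in _ + X](reindex_inj (@perm_inj _ edge)) /=.
  by under [X in _ + X]eq_bigr do rewrite edgeK wP; rewrite F2_addrr.
have FE: (F :&: kermx bd_mx <= N :&: E)%MS.
  apply/row_subP=> i; set v := row i _.
  have: (v <= F :&: kermx bd_mx)%MS by apply: row_sub.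
  rewrite !sub_capmx sub_kermx => /andP[vF /eqP v0].
  have vE x: at_pt v (edge x) = at_pt v x.
    have: at_pt (v *m bd_mx) x = 0 by rewrite v0 /at_pt mxE.
    rewrite at_bd_mx => /eqP; rewrite addr_eq0 => /eqP->.
    by apply/eqP; rewrite -addr_eq0 F2_addrr.
  apply/andP; split; apply/sub_orbit_mxP=> // x.
  by rewrite -vE face_edge_node.
(* Components and regions are the vertices of a connected graph whose edges are
   the faces, so R + x <= F + 1: the next steps prove this by dimensions. *)
have GX: (\rank (G :&: (N :&: E)) <= 1)%N.
  suff : (G :&: (N :&: E) <= (const_mx 1 : 'rV['F_2]_#|T|))%MS.
    by move/mxrankS/leq_trans; apply; apply: rank_leq_row.
  apply/row_subP=> i; set v := row i _.
  have: (v <= G :&: (N :&: E))%MS by apply: row_sub.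
  rewrite !sub_capmx => /and3P[/sub_level_mxP vG /sub_orbit_mxP vN /sub_orbit_mxP vE].
  have vc x y: at_pt v x = at_pt v y.
    have /connectP[q] := connected x y.
    elim: q x => [|a q IHq] x /= => [_ -> //|/andP[xa qP] /(IHq _ qP) <-].
    by case/or3P: xa => /eqP ax; [rewrite ax vN | rewrite ax vE | apply: vG].
  apply/submxP; case: (pickP (@predT T)) => [x _|T0]; last first.
    by exists 0; apply: at_inj => x; have := T0 x.
  exists (at_pt v x)%:M; apply: at_inj => y.
  by rewrite mul_scalar_mx {2}/at_pt !mxE mulr1; apply: vc.
have GF: (G + (N :&: E) <= F)%MS.
  rewrite addsmx_sub; apply/andP; split; apply/row_subP=> i; set v := row i _.
    have /sub_level_mxP vG: (v <= G)%MS by apply: row_sub.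
    by apply/sub_orbit_mxP=> x; apply: vG.
  have: (v <= N :&: E)%MS by apply: row_sub.
  rewrite sub_capmx => /andP[/sub_orbit_mxP vN /sub_orbit_mxP vE].
  by apply/sub_orbit_mxP=> x; rewrite /face permM -vN permKV vE.
have rankZ := mxrank_ker (col_mx N E)^T.
have rG: \rank G = #|Rg|.
  rewrite rank_level_mx; apply/eqP; rewrite eqn_leq max_card /=.
  apply/subset_leq_card/subsetP=> R _.
  by have [d <-] := reg_onto R; apply: imset_f.
have ZB: (Z <= F *m bd_mx)%MS.
  rewrite -(geq_leqif (mxrank_leqif_sup BZ)).
  rewrite mxrank_tr -addsmxE in rankZ.
  have s1 := mxrank_sum_cap N E; have s2 := mxrank_mul_ker F bd_mx.
  have s3 := mxrank_sum_cap G (N :&: E)%MS; have le1 := mxrankS FE.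
  have le2 := mxrankS GF; have le3 := card_le_edges.
  rewrite rG (rank_orbit_mx node) (rank_orbit_mx edge) (rank_orbit_mx face)
    in s1 s2 s3 le2.
  rewrite [leqLHS]rankZ.
  exact: rank_count euler le3 s1 s2 s3 le1 le2 GX.
have /submx_trans/(_ ZB)/submxP[a Da]: (row_of z <= Z)%MS.
  apply: subZ; apply: orthogonal_rows => w /sub_orbit_mxP wP.
    by under eq_bigr do rewrite at_row_of; apply: zN.
  by under eq_bigr do rewrite at_row_of; apply: zE.
have aF: (a *m F <= F)%MS by apply: submxMl.
exists (at_pt (a *m F)) => d; split; first exact: (sub_orbit_mxP _ _ aF).
by rewrite -at_bd_mx -mulmxA -Da at_row_of.
Qed.

End Bounding.

(** * Orienting the orbits of two involutions *)

Section Dihedral.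
Variables (T : finType) (a b : T -> T).
Hypotheses (aK : involutive a) (bK : involutive b).
Hypotheses (a_free : forall x, a x != x) (b_free : forall x, b x != x).

Let t x := b (a x).

Lemma dihedral_inj : injective t.
Proof. by move=> x y /(inv_inj bK)/(inv_inj aK). Qed.

(** The map x |-> b (a x) and the two involutions generate a dihedral group.  If a
point and its image under [a] were in one orbit of this map, then a reflection of
the group would fix a point of the orbit, and so would [a] or [b]. *)
Lemma dihedral_iter_neq k x : iter k t x != a x.
Proof.
elim/ltn_ind: k x => -[|[|k]] IHk x.
- by rewrite eq_sym a_free.
- by rewrite b_free.
apply: contra_neq (IHk k (leqnSn _) (t x)) => E.
by rewrite -iterSr /t -E /= bK aK.
Qed.

Lemma dihedral_cover x y :
    connect [rel u v | (v == a u) || (v == b u)] x y ->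
  fconnect t x y || fconnect t x (a y).
Proof.
case/connectP=> q xq ->.
suff gen u: fconnect t x u || fconnect t x (a u) ->
    path [rel u v | (v == a u) || (v == b u)] u q ->
    fconnect t x (last u q) || fconnect t x (a (last u q)).
  by apply: gen xq; rewrite connect0.
elim: q u {xq} => [|z q IHq] u //= xu /andP[uz zq].
apply: IHq zq; case/orP: uz => /eqP->; first by rewrite aK orbC.
case/orP: xu => xu; apply/orP; [right | left].
  by rewrite (same_fconnect1_r dihedral_inj) /t aK bK.
by rewrite (same_fconnect1_r dihedral_inj) /t aK in xu; apply: xu.
Qed.

(** On each class, the points in the [t]-orbit of a chosen representative form one
orientation, and their images under [a] the opposite one. *)
Lemma dihedral_orientation (K : eqType) (k : T -> K) :
    (forall x y, connect [rel u v | (v == a u) || (v == b u)] x y = (k x == k y)) ->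
  exists w : T -> bool, forall x, w (a x) = ~~ w x /\ w (b x) = ~~ w x.
Proof.
move=> kP; pose root x := odflt x [pick y | k y == k x].
have root_eq x y : k x = k y -> root x = root y.
  rewrite /root => kxy; rewrite (eq_pick (Q := fun z => k z == k y)) => [|z].
    by case: pickP => // /(_ y); rewrite eqxx.
  by rewrite /= kxy.
have k_root x : k (root x) = k x.
  by rewrite /root; case: pickP => [y /eqP|/(_ x)]; rewrite ?eqxx.
have ka x : k (a x) = k x.
  by apply/esym/eqP; rewrite -kP connect1 //= eqxx.
have kb x : k (b x) = k x.
  by apply/esym/eqP; rewrite -kP connect1 //= eqxx orbT.
pose w x := fconnect t (root x) x.
have wa x : w (a x) = ~~ w x.
  rewrite /w (root_eq _ _ (ka x)).
  have: fconnect t (root x) x || fconnect t (root x) (a x).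
    by apply: dihedral_cover; rewrite kP k_root.
  have [rx _|_ /= -> //] := boolP (fconnect t _ x); apply/negP=> rax.
  have xax: fconnect t x (a x).
    by apply: connect_trans rax; rewrite fconnect_sym //; apply: dihedral_inj.
  by have /eqP[] := dihedral_iter_neq (findex t x (a x)) x; rewrite iter_findex.
exists w => x; split=> //; rewrite -wa /w (root_eq (b x) (a x)) ?ka ?kb //.
by rewrite [RHS](same_fconnect1_r dihedral_inj) /t aK.
Qed.
End Dihedral.

(** * Half-edges of a diagram and alternating signs *)

Section Diagram.
Variables (r : nat) (D : diagram r).
Implicit Types d e : dart D.

Lemma edgeK : involutive (edge D).
Proof. by move=> d; have [_ /(_ d)[]] := diagram_ok D. Qed.

Lemma edge_neq d : edge D d != d.
Proof. by have [_ /(_ d)[]] := diagram_ok D. Qed.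

Lemma crossing_node d : crossing (node D d) = crossing d.
Proof.
have /eqP E: porbit (node D) (node D d) == porbit (node D) d.
  by rewrite eq_porbit_mem (mem_porbit (node D) 1 d).
by rewrite /crossing E.
Qed.

Lemma iter_node_orbit d : iter #|porbit (node D) d| (node D) d = d.
Proof. by rewrite iter_porbit. Qed.

Lemma iter_node_neq k d : (0 < k < #|porbit (node D) d|)%N -> iter k (node D) d != d.
Proof.
move=> /andP[k0 kd]; have := uniq_traject_porbit (node D) d.
case: #|_| kd => // n; rewrite /= ltnS => kn /andP[/negP nd _].
apply/eqP=> E; apply: nd; apply/trajectP; exists k.-1; first by lia.
by rewrite -iterSr prednK.
Qed.

Lemma crossing_card d : crossing d = false -> #|porbit (node D) d| = 2%N.
Proof.
have [/(_ d) + _ _ _ _] := diagram_ok D.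
by rewrite /marked_point => /orP[-> //|/eqP].
Qed.

(** A vertex has two or four half-edges, so half a turn tells them apart. *)
Lemma crossingE d : crossing d = (node D (node D d) != d).
Proof.
case dX: (crossing d); last first.
  by have := iter_node_orbit d; rewrite crossing_card //= => ->; rewrite eqxx.
by rewrite (@iter_node_neq 2) // (eqP dX).
Qed.

Lemma node_neq d : node D d != d.
Proof.
apply: (@iter_node_neq 1); case dX: (crossing d); first by rewrite (eqP dX).
by rewrite crossing_card.
Qed.

Lemma crossing_node4 d : crossing d -> iter 4 (node D) d = d.
Proof. by move=> /eqP dX; rewrite -[RHS]iter_node_orbit dX. Qed.

Lemma node4 d : iter 4 (node D) d = d.
Proof.
case dX: (crossing d); first exact: crossing_node4.
by move/negbT: dX; rewrite crossingE negbK => /eqP /= E; rewrite !E.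
Qed.

Lemma opp_crossing d : crossing d -> opp d = node D (node D d).
Proof. by rewrite /opp => ->. Qed.

Lemma opp_marked d : crossing d = false -> opp d = node D d.
Proof. by rewrite /opp => ->. Qed.

Lemma crossing_opp d : crossing (opp d) = crossing d.
Proof. by rewrite /opp (fun_if (@crossing r D)) !crossing_node if_same. Qed.

Lemma node2_marked d : crossing d = false -> node D (node D d) = d.
Proof. by rewrite crossingE => /negbFE/eqP. Qed.

Lemma oppK : involutive (@opp r D).
Proof.
move=> d; rewrite {1}/opp crossing_opp; case: ifP => dX.
  by rewrite opp_crossing //; apply: node4.
by rewrite opp_marked // node2_marked.
Qed.

Lemma opp_neq d : opp d != d.
Proof. by rewrite /opp; case: ifP => dX; rewrite ?node_neq -?crossingE. Qed.

Lemma over_node d : over (node D d) = crossing d && ~~ over d.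
Proof. by have [_ _ /(_ d)] := diagram_ok D. Qed.

Lemma over_opp d : over (opp d) = over d.
Proof.
rewrite /opp; case: ifP => dX; first by rewrite !over_node crossing_node dX /= negbK.
by rewrite over_node -[in RHS](node2_marked dX) over_node crossing_node dX.
Qed.

Lemma comp_connect d e :
  connect [rel a b | (b == edge D a) || (b == opp a)] d e = (comp d == comp e).
Proof. by have [_ _ _ [->]] := diagram_ok D. Qed.

Lemma comp_edge d : comp (edge D d) = comp d.
Proof. by apply/esym/eqP; rewrite -comp_connect connect1 //= eqxx. Qed.

Lemma comp_opp d : comp (opp d) = comp d.
Proof. by apply/esym/eqP; rewrite -comp_connect connect1 //= eqxx orbT. Qed.

Lemma nonself_opp d : nonself (opp d) = nonself d.
Proof.
rewrite /nonself crossing_opp; case dX: (crossing d) => //=.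
rewrite comp_opp; congr (_ != _).
by rewrite -[in RHS]comp_opp !opp_crossing ?crossing_node.
Qed.

Lemma comp_nodeV d : crossing d -> comp ((node D)^-1%g d) = comp (node D d).
Proof.
move=> dX; rewrite -[in RHS](permKV (node D) d) -opp_crossing ?comp_opp //.
by rewrite -crossing_node permKV.
Qed.

(** The components other than K_i form a cycle modulo 2: it enters every vertex
along a strand and leaves it along the opposite half-edge. *)
Lemma mod2_coloring (i : 'I_r) : exists c : dart D -> bool, forall d,
  c (face D d) = c d /\ c (edge D d) = c d (+) (comp d != i).
Proof.
have [_ _ _ _ [regF regO conn euler]] := diagram_ok D.
pose z d : 'F_2 := (comp d != i)%:R.
have zz g v : involutive g -> (forall d, g d != d) ->
    (forall d, comp (g d) = comp d) -> (forall d, at_pt v (g d) = at_pt v d) ->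
    \sum_d z d * at_pt v d = 0.
  by move=> gK gN cg vg; apply: (@sum_involution_F2 _ g) => // d; rewrite /z cg vg.
have [||c cP] := @cycle_bounds _ _ (node D) (edge D) _ edgeK regF regO conn euler z.
- move=> v vN; apply: (zz (@opp r D)); [exact: oppK|exact: opp_neq|exact: comp_opp|].
  by move=> d; rewrite /opp; case: ifP; rewrite !vN.
- by move=> v vE; apply: (zz (edge D)); [exact: edgeK|exact: edge_neq|exact: comp_edge|].
exists (fun d => c d != 0) => d; have [-> zE] := cP d; split=> //.
move: (c d) (c (edge D d)) (comp d != i) (zE : _ = (_ != _)%:R) => x y b /(congr1 val).
by case: x y b => [[|[|//]] ?] [[|[|//]] ?] [].
Qed.

Lemma orientation : exists w : dart D -> bool,
  forall d, w (edge D d) = ~~ w d /\ w (opp d) = ~~ w d.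
Proof.
apply: (dihedral_orientation edgeK oppK edge_neq opp_neq (k := @comp r D)).
exact: comp_connect.
Qed.

(** Following a strand alternates between [edge] and [opp], so the sign is restored
by each passage that is not non-self and reversed by each one that is: it is the
parity of the number of letters read so far. *)
Definition alternating (s : dart D -> bool) : Prop :=
  forall d, s (edge D d) = ~~ s d /\ s (opp d) = s d (+) ~~ nonself d.

Lemma face_edge d : face D (edge D d) = (node D)^-1%g d.
Proof. by rewrite /face permM edgeK. Qed.

Lemma coloring_nodeV i (c : dart D -> bool) :
    (forall d, c (face D d) = c d /\ c (edge D d) = c d (+) (comp d != i)) ->
  forall d, c ((node D)^-1%g d) = c d (+) (comp d != i).
Proof. by move=> cP d; have [_ <-] := cP d; rewrite -face_edge (cP _).1. Qed.

(** Turning from [d] to [opp d] means crossing the other strand of the vertex and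
then the strand of [d] itself, across which the colour does not change. *)
Lemma coloring_opp i (c : dart D -> bool) :
    (forall d, c (face D d) = c d /\ c (edge D d) = c d (+) (comp d != i)) ->
  forall d, comp d = i -> c (opp d) = c d (+) nonself d.
Proof.
move=> cP d di; have cV := coloring_nodeV cP.
have := cV (node D d); rewrite permK => ->; rewrite /nonself di /opp.
case: ifP => dX /=; last first.
  by rewrite -opp_marked // comp_opp di eqxx !addbF.
have := cV (node D (node D d)); rewrite permK => ->.
by rewrite -opp_crossing // comp_opp di eqxx addbF addbK.
Qed.

(** The colour to the left along K_i changes only at non-self crossings, and the
orientation changes at every step. *)
Lemma ex_alternating : exists s, alternating s.
Proof.
have [w wP] := orientation.
have [c cP] := fin_all_exists mod2_coloring.
exists (fun d => c (comp d) d (+) w d) => d; have [we wo] := wP d.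
rewrite comp_edge comp_opp we wo (cP _ d).2 eqxx addbF addbN; split=> //.
by rewrite (coloring_opp (cP (comp d))) //; case: (c _ d); case: (w d); case: (nonself d).
Qed.

(** Each non-self passage of K_i is counted twice, once at either half-edge. *)
Definition weight (s : dart D -> bool) (i : 'I_r) : rat :=
  \sum_(d | (comp d == i) && nonself d) (-1) ^+ (s d (+) over d).

End Diagram.

(** * OU numbers as signed counts *)

Lemma Phi_cons (X : bool) (S : seq bool) :
  Phi (X :: S) = 2%:R^-1 * (-1) ^+ X - Phi S.
Proof.
rewrite /Phi /= big_ord_recl mulrDr -mulrN -sumrN; congr (_ * _ + _ * _).
  by rewrite /eps; case: X.
apply: eq_bigr => j _; rewrite /= /eps /=.
by case: (nth _ _ _); case: (odd j); rewrite ?opprK.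
Qed.

Section Weight.
Variables (r : nat) (D : diagram r).
Implicit Types d e : dart D.

(** Along a travelled path an alternating sign changes exactly on leaving a
non-self crossing, as [eps] does when the place in the OU sequence grows by one. *)
Lemma Phi_path (s : dart D -> bool) d (q : seq (dart D)) :
    alternating s -> fpath (@travel r D) d q ->
  \sum_(e <- q | nonself e) (-1) ^+ (s e (+) over e)
    = (-1) ^+ (~~ s d) * 2%:R * Phi [seq over e | e <- q & nonself e].
Proof.
move=> sP; elim: q d => [|x q IHq] d /= => [_|].
  by rewrite big_nil /Phi /= big_ord0 !mulr0.
case/andP=> /eqP dx qP; rewrite big_cons (IHq x qP).
have sx : s x = ~~ s d (+) ~~ nonself x.
  by rewrite -dx /travel nonself_opp (sP (edge D d)).2 (sP d).1.
case: ifP sx => /= _ ->; last by case: (s d).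
rewrite Phi_cons; set P := Phi _.
by case: (s d); case: (over x); rewrite /= ?expr0 ?expr1; field.
Qed.

(** Travelling preserves the component and the orientation.  Conversely, the
component is covered by the orbit of [d] and its image under [edge], and the
latter is oriented the other way. *)
Lemma travel_orbit w d e :
    (forall d, w (edge D d) = ~~ w d /\ w (opp d) = ~~ w d) ->
  (e \in fingraph.orbit (@travel r D) d) = (comp e == comp d) && (w e == w d).
Proof.
move=> wP; rewrite -fconnect_orbit.
have inv x y : fconnect (@travel r D) x y -> comp y = comp x /\ w y = w x.
  move/iter_findex <-; elim: (findex _ _ _) => //= k [IHc IHw].
  by rewrite comp_opp comp_edge (wP _).2 (wP _).1 negbK.
apply/idP/andP => [/inv[-> ->]|[/eqP ced /eqP wed]]; first by [].
have := dihedral_cover (@edgeK r D) (@oppK r D) (x := d) (y := e).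
rewrite comp_connect ced eqxx => /(_ isT)/orP[//|/inv[_]].
by rewrite (wP e).1 wed; case: (w d).
Qed.

(** The two orientations of the component give equal sums, as the half-edges [d] and
[opp d] of a non-self passage have equal signs and equal letters. *)
Lemma weight_OU (s : dart D -> bool) i : alternating s -> OU_number D i = `|weight s i| / 4%:R.
Proof.
move=> sP; rewrite /OU_number; case: pickP => [d /eqP di|none]; last first.
  by rewrite /weight big_pred0 ?normr0 ?mul0r // => d; rewrite none.
have [w wP] := orientation D.
(* The orbit of [d] is the path that starts one step before it. *)
have pth : fpath (@travel r D) (edge D (opp d)) (fingraph.orbit (@travel r D) d).
  have := fpath_traject (@travel r D) (edge D (opp d)) (fingraph.order (@travel r D) d).
  by rewrite [travel (edge _ _)]/travel edgeK oppK.
have := Phi_path sP pth; rewrite -/(OU_seq d); set P := Phi _ => sumE.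
suff -> : weight s i = (-1) ^+ (~~ s (edge D (opp d))) * 4%:R * P.
  by rewrite !normrM normr_sign mul1r normr_nat [RHS]mulrC mulKf ?pnatr_eq0.
have -> : 4%:R = 2%:R * 2%:R :> rat by [].
rewrite [_ ^+ _ * _]mulrCA -mulrA -sumE /weight (bigID (fun e => w e == w d)) /=.
set A := (X in X + _ = _); rewrite [X in _ + X = _](_ : _ = A); last first.
  rewrite (reindex_inj (inv_inj (@oppK r D))) /=.
  apply: eq_big => e; rewrite comp_opp nonself_opp (wP e).2.
    by case: (w e); case: (w d).
  case/andP=> /andP[_ ns] _.
  by rewrite over_opp (sP e).2 ns addbF.
rewrite -mulr2n mulr_natl; congr (_ *+ _).
have Uq : uniq (fingraph.orbit (@travel r D) d) by apply: orbit_uniq.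
rewrite [RHS]big_mkcond (big_uniq _ Uq) /= [LHS]big_mkcond [RHS]big_mkcond.
apply: eq_bigr => e _; rewrite (travel_orbit _ _ wP) di.
by case: (comp e == i); case: (nonself e); case: (w e == w d).
Qed.
End Weight.

(** * Isotopies and moves of types RI and RII *)

Section Term.
Variables (r : nat) (D : diagram r) (s : dart D -> bool) (i : 'I_r).

Definition weight_at (d : dart D) : rat :=
  if (comp d == i) && nonself d then (-1) ^+ (s d (+) over d) else 0.

Lemma weight_sum : weight s i = \sum_d weight_at d.
Proof. exact: big_mkcond. Qed.

Lemma weight_at_self d : nonself d = false -> weight_at d = 0.
Proof. by rewrite /weight_at andbC => ->. Qed.

Lemma nonself_marked (d : dart D) : crossing d = false -> nonself d = false.
Proof. by rewrite /nonself => ->. Qed.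

(** This applies to the two new passages of a strand in a move of type RII, where
[d] and [e] are the ends of an edge of the bigon or continue it outwards. *)
Lemma weight_at_cancel (d e : dart D) :
    comp d = comp e -> nonself d = nonself e -> over d = over e ->
  s d = ~~ s e -> weight_at d + weight_at e = 0.
Proof.
rewrite /weight_at => -> -> -> ->; case: ifP => _; last exact: addr0.
by rewrite addNb signrN addNr.
Qed.

End Term.

Lemma sum_embedding (T T' : finType) (f : T -> T') (N : seq T') (F : T' -> rat) :
    injective f -> uniq N -> (forall y, (y \in codom f) = (y \notin N)) ->
  \sum_y F y = \sum_x F (f x) + \sum_(y <- N) F y.
Proof.
move=> injf uN fN; rewrite (bigID (mem N)) /= addrC (big_uniq _ uN); congr (_ + _).
have uf : uniq (codom f) by rewrite codomE map_inj_uniq ?enum_uniq.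
by rewrite -(eq_bigl _ _ fN) -(big_uniq _ uf) codomE big_map big_enum.
Qed.

Section Agree.
Variables (r : nat) (D D' : diagram r) (f : dart D -> dart D').
Variables (N : seq (dart D')) (A B : pred (dart D)) (a : seq (dart D)).
Hypothesis fP : agree_off f N A B.
Hypothesis Aa : forall d, A d = (d \in a).
Hypothesis a_node : {in a, forall d, node D d \in a /\ crossing d = false}.

Let injf : injective f. Proof. by case: fP. Qed.

Lemma notin_a_node d : (node D d \in a) = (d \in a).
Proof.
apply/idP/idP => [nd|/a_node[]//].
have [nnd] := a_node nd; rewrite crossing_node => dX.
by rewrite node2_marked in nnd.
Qed.

Lemma agree_vertex d : d \notin a ->
  [/\ crossing (f d) = crossing d, opp (f d) = f (opp d),
      nonself (f d) = nonself d & over (f d) = over d].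
Proof.
case: fP => _ _ fc fA _ da.
have [nf of_] : node D' (f d) = f (node D d) /\ over (f d) = over d.
  by apply: fA; rewrite Aa.
have [nnf _] : node D' (f (node D d)) = f (node D (node D d)) /\
    over (f (node D d)) = over (node D d).
  by apply: fA; rewrite Aa notin_a_node.
have Xf : crossing (f d) = crossing d.
  by rewrite !crossingE nf nnf (inj_eq injf).
by split=> //; rewrite /opp /nonself Xf ?nf ?nnf ?fc //; case: ifP.
Qed.

(** The half-edges in [a] are at marked points that the move may turn into
crossings, and [N] lists the new half-edges.  The alternating sign is pulled back
from the larger diagram along [f]. *)
Lemma OU_number_embedding :
    (forall s, alternating s ->
       [/\ forall d, B d -> s (f (edge D d)) = ~~ s (f d),
           {in a, forall d, s (f (node D d)) = ~~ s (f d)}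
         & forall i, \sum_(d in a) weight_at s i (f d)
                     + \sum_(d' <- N) weight_at s i d' = 0]) ->
  forall i, OU_number D' i = OU_number D i.
Proof.
move=> sP i; have [s sA] := ex_alternating D'.
have [sB sa sum0] := sP s sA; case: fP => _ [uN fN] fc _ fB.
have s'A : alternating (s \o f).
  move=> d /=; split.
    have [/sB//|/fB <-] := boolP (B d); exact: (sA _).1.
  have [da|/agree_vertex[_ <- <- _]] := boolP (d \in a); last exact: (sA _).2.
  have [_ dX] := a_node da.
  by rewrite nonself_marked // addbT opp_marked // sa.
rewrite (weight_OU i sA) (weight_OU i s'A) !weight_sum; congr (`|_| / _).
rewrite (sum_embedding _ injf uN fN) (bigID (mem a)) /= addrAC sum0 add0r.
rewrite [RHS](bigID (mem a)) /= [X in _ = X + _]big1 ?add0r => [|d /a_node[_ dX]].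
  by apply: eq_bigr => d /agree_vertex[_ _ nf of_]; rewrite /weight_at fc nf of_.
by rewrite weight_at_self ?nonself_marked.
Qed.
End Agree.

Section Moves.
Variables (r : nat) (D D' : diagram r).

Lemma OU_number_isotopic : isotopic D D' -> forall i, OU_number D' i = OU_number D i.
Proof.
case=> f [fP _ _].
apply: (OU_number_embedding (a := [::]) fP) => // s sA; split=> // i.
by rewrite big_pred0 // big_nil addr0.
Qed.

Lemma OU_number_subdivision :
  subdivision D D' -> forall i, OU_number D' i = OU_number D i.
Proof.
case=> f [x [u [v [fP [xu xv] [uv vu] _ _]]]].
have [uX vX] : crossing u = false /\ crossing v = false.
  by split; rewrite crossingE ?uv ?vu ?uv eqxx.
apply: (OU_number_embedding (a := [::]) fP) => // s sA; split=> // [d|i].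
  have xx : s (f (edge D x)) = ~~ s (f x).
    rewrite -[LHS]negbK -(sA _).1 xv -uv -opp_marked // (sA _).2.
    by rewrite nonself_marked // addbT -xu (sA _).1 !negbK.
  by case/pred2P=> ->; rewrite ?edgeK xx ?negbK.
rewrite big_pred0 // add0r big_cons big_seq1.
by rewrite !weight_at_self ?nonself_marked ?addr0.
Qed.

Lemma not_crossing (d : dart D) : marked_point d -> crossing d = false.
Proof. by rewrite /marked_point /crossing => /eqP->. Qed.

Lemma OU_number_RI :
  RI_move D D' -> forall i, OU_number D' i = OU_number D i.
Proof.
case=> f [x [y [u [v [[/not_crossing xM xy] fP [[fx fy uv vx] euv] _ _]]]]].
have [_ [_ fN] _ _ _] := fP.
have yx : node D y = x by rewrite -xy node2_marked.
have xX : crossing (f x).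
  rewrite crossingE fx fy; have := fN u; rewrite !inE eqxx /=.
  by apply: contraFneq => ->; apply: codom_f.
have yX : crossing (f y) by rewrite -fx crossing_node.
have xu : opp (f x) = u by rewrite opp_crossing // fx fy.
have yv : opp (f y) = v by rewrite opp_crossing // fy uv.
have cu : comp u = comp (f x) by rewrite -xu comp_opp.
have cv : comp v = comp (f x) by rewrite -euv comp_edge.
have cy : comp (f y) = comp (f x) by rewrite -cv -yv comp_opp.
have nx : nonself (f x) = false by rewrite /nonself fx cy eqxx andbF.
have ny : nonself (f y) = false by rewrite /nonself fy cy cu eqxx andbF.
have nu : nonself u = false by rewrite /nonself uv cv cu eqxx andbF.
have nv : nonself v = false by rewrite /nonself vx cv eqxx andbF.
apply: (OU_number_embedding (a := [:: x; y]) fP) => [d|d|s sA].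
- by rewrite !inE.
- by rewrite !inE => /pred2P[]->; rewrite ?xy ?yx eqxx ?orbT -?xy ?crossing_node.
split=> // [d|i].
  have sxy : s (f y) = ~~ s (f x).
    have := (sA (f y)).2; rewrite yv ny addbT => /(congr1 negb); rewrite negbK => <-.
    by rewrite -euv (sA u).1 -xu (sA _).2 nx addbT negbK.
  by rewrite !inE => /pred2P[]->; rewrite ?xy ?yx sxy ?negbK.
rewrite big_cons big_seq1 !weight_at_self // !addr0 big1 // => d.
by rewrite !inE => /pred2P[]->; rewrite weight_at_self.
Qed.

Lemma OU_number_RII :
  RII_move D D' -> forall i, OU_number D' i = OU_number D i.
Proof.
case=> f [x [y [z [w [u [v [S [t [[H1 fP] [W E] [uv st oxy] _ _]]]]]]]]].
case: H1 => /not_crossing xM /not_crossing zM xy zw Uxyzw.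
case: W => fx fz us sx; case: E => fy tv vw wy.
have [_ [_ fN] fc _ _] := fP.
have yx : node D y = x by rewrite -xy node2_marked.
have wz : node D w = z by rewrite -zw node2_marked.
have xX : crossing (f x).
  rewrite crossingE fx fz; have := fN u; rewrite !inE eqxx /=.
  by apply: contraFneq => ->; apply: codom_f.
have yX : crossing (f y).
  rewrite crossingE fy tv; have := fN v; rewrite !inE eqxx orbT /=.
  by apply: contraFneq => ->; apply: codom_f.
have zX : crossing (f z) by rewrite -fx crossing_node.
have wX : crossing (f w) by rewrite -crossing_node wy.
have uX : crossing u by rewrite -fz crossing_node.
have vX : crossing v by rewrite -crossing_node vw.
have xu : opp (f x) = u by rewrite opp_crossing // fx fz.
have zs : opp (f z) = S by rewrite opp_crossing // fz us.
have yv : opp (f y) = v by rewrite opp_crossing // fy tv.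
have wt : opp (f w) = t by rewrite opp_crossing // wy fy.
have cu : comp u = comp (f x) by rewrite -xu comp_opp.
have cv : comp v = comp (f x) by rewrite -uv comp_edge.
have cy : comp (f y) = comp (f x) by rewrite -cv -yv comp_opp.
have cs : comp S = comp (f z) by rewrite -zs comp_opp.
have ct : comp t = comp (f z) by rewrite -st comp_edge.
have cw : comp (f w) = comp (f z) by rewrite -ct -wt comp_opp.
have nyx : nonself (f y) = nonself (f x).
  by rewrite /nonself xX yX fx fy ct cy.
have nzx : nonself (f z) = nonself (f x).
  by rewrite /nonself xX zX fx fz cu eq_sym.
have nwx : nonself (f w) = nonself (f x).
  by rewrite /nonself wX xX wy fx cy cw eq_sym.
have ozw : over (f z) = over (f w).
  by rewrite -fx over_node xX oxy -wy over_node wX negbK.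
apply: (OU_number_embedding (a := [:: x; y; z; w]) fP) => // [d|s sA].
  rewrite !inE => /or4P[]/eqP->; rewrite ?xy ?yx ?zw ?wz eqxx ?orbT.
  - by [].
  - by rewrite -xy crossing_node.
  - by [].
  by rewrite -zw crossing_node.
(* Two passages with the same value of [nonself] and one edge between them
   reverse the sign along each strand, as the marked points did. *)
have sxy : s (f y) = ~~ s (f x).
  have := (sA (f y)).2; rewrite yv -uv (sA u).1 -xu (sA _).2 nyx.
  by case: (s _); case: (s _); case: nonself.
have szw : s (f w) = ~~ s (f z).
  have := (sA (f w)).2; rewrite wt -st (sA S).1 -zs (sA _).2 nwx nzx.
  by case: (s _); case: (s _); case: nonself.
split=> // [d|i].
  by rewrite !inE => /or4P[]/eqP->; rewrite ?xy ?yx ?zw ?wz ?sxy ?szw ?negbK.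
rewrite -(big_uniq _ Uxyzw) /= !big_cons !big_nil !addr0.
have xy0 : weight_at s i (f x) + weight_at s i (f y) = 0.
  by apply: weight_at_cancel; rewrite ?sxy ?negbK.
have zw0 : weight_at s i (f z) + weight_at s i (f w) = 0.
  by apply: weight_at_cancel; rewrite ?szw ?negbK // nzx nwx.
have uv0 : weight_at s i u + weight_at s i v = 0.
  apply: weight_at_cancel; rewrite -?uv ?comp_edge ?(sA _).1 ?negbK //.
    by rewrite uv -xu -yv !nonself_opp.
  by rewrite uv -xu -yv !over_opp.
have st0 : weight_at s i S + weight_at s i t = 0.
  apply: weight_at_cancel; rewrite -?st ?comp_edge ?(sA _).1 ?negbK //.
    by rewrite st -zs -wt !nonself_opp nzx.
  by rewrite st -zs -wt !over_opp.
by rewrite addrA xy0 zw0 !add0r addrA uv0 st0 addr0.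
Qed.
End Moves.

(** * Moves of type RIII *)

Section Triangle.
Variables (r : nat) (D : diagram r) (u m l : dart D).
Hypothesis tri : RIII_triangle u m l.

Let side := triangle_side u m l.
Let swap := RIII_swap u m l.

Lemma uniq_triangle : uniq [:: u; m; l].
Proof. by case: tri => _ [_] /map_uniq. Qed.

Lemma triangle_face x : (face D x \in [:: u; m; l]) = (x \in [:: u; m; l]).
Proof.
case: tri => pu _ _ _ _.
have inE3 y : (y \in [:: u; m; l]) = (y \in porbit (face D) u).
  by rewrite pu !inE orbA.
by rewrite !inE3 -!eq_porbit_mem (porbit_perm _ 1).
Qed.

(** Whether [m] or [l] follows [u] depends on the diagram: both occur. *)
Lemma triangle_neighbours :
  [/\ face D u = m, face D m = l & face D l = u]
  \/ [/\ face D u = l, face D l = m & face D m = u].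
Proof.
case: tri => pu _ _ _ _; have Utri := uniq_triangle.
have p3 : #|porbit (face D) u| = 3%N.
  by rewrite pu -[RHS](card_uniqP Utri); apply: eq_card => y; rewrite !inE orbA.
have f3 : face D (face D (face D u)) = u.
  by have := iter_porbit (face D) u; rewrite p3.
have tr := porbit_traject (face D) u; rewrite p3 pu in tr.
move: Utri (tr m) (tr l); rewrite /= !inE !eqxx !orbT /=.
rewrite !negb_or -!andbA => /and4P[um ul ml _].
rewrite [m == u]eq_sym [l == u]eq_sym (negPf um) (negPf ul) /=.
case/esym/orP=> /eqP mE /esym/orP[]/eqP lE.
- by rewrite mE lE eqxx in ml.
- by left; rewrite mE lE.
- by right; rewrite mE lE.
- by rewrite mE lE eqxx in ml.
Qed.

Lemma triangle_vertex x y : x \in [:: u; m; l] -> y \in [:: u; m; l] ->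
  porbit (node D) x = porbit (node D) y -> x = y.
Proof.
case: tri => _ [_ U] _ _ _; move: U; rewrite /= !inE negb_or -!andbA.
case/and4P=> /eqP um /eqP ul /eqP ml _.
by move=> /or3P[]/eqP-> /or3P[]/eqP-> //; try case/esym.
Qed.

Lemma triangle_crossing x : x \in [:: u; m; l] -> crossing x.
Proof. by case: tri => _ [/allP Xtri _] _ _ _; apply: Xtri. Qed.

Lemma side_edge d : side (edge D d) = side d.
Proof. by rewrite /side /triangle_side edgeK orbC. Qed.

(** At the corner where [x] starts, the half-edge of the incoming side is the next one
counterclockwise, because the triangle lies to the left. *)
Lemma side_corner d : side d ->
  exists2 x, x \in [:: u; m; l] & d = x \/ d = node D x.
Proof.
case/orP=> dT; first by exists d => //; left.
exists ((node D)^-1%g d); last by right; rewrite permKV.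
by rewrite -face_edge triangle_face.
Qed.
Lemma edge_triangle x : x \in [:: u; m; l] -> edge D x \notin [:: u; m; l].
Proof.
move=> xT; apply/negP; rewrite -triangle_face face_edge => vT.
have /eqP[] := node_neq ((node D)^-1%g x); rewrite permKV.
by apply: triangle_vertex => //; rewrite -[in LHS](permKV (node D) x) (porbit_perm _ 1).
Qed.

Lemma side_crossing d : side d -> crossing d.
Proof.
move=> /side_corner[x /triangle_crossing xX [->|->]] //.
by rewrite crossing_node.
Qed.

(** The two sides at a corner are adjacent in its cyclic order, hence not opposite,
and no crossing is the corner of two pairs of sides. *)
Lemma side_oppN d : side d -> side (opp d) = false.
Proof.
move=> dT; have dX := side_crossing dT; apply/negP => odT.
have [x xT dx] := side_corner dT; have [y yT dy] := side_corner odT.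
have node_porbit z : porbit (node D) (node D z) = porbit (node D) z.
  by rewrite -[RHS](porbit_perm _ 1).
have xy : x = y.
  apply: triangle_vertex => //.
  rewrite opp_crossing // in dy.
  have <- : porbit (node D) d = porbit (node D) x by case: dx => ->.
  rewrite -node_porbit -[LHS]node_porbit.
  by case: dy => ->.
rewrite -{y yT}xy opp_crossing // in dy.
have x4 := node4 x; move: dX dx dy; rewrite crossingE => /eqP ndd [dx|dx] [] dy.
- by rewrite dy dx in ndd.
- by have /eqP[] := node_neq (node D x); rewrite -[RHS]dy dx.
- by have /eqP[] := node_neq x; rewrite -[RHS]x4 /= -dx dy -dx.
- by rewrite dy dx in ndd.
Qed.

Lemma swapK : involutive swap.
Proof.
rewrite /swap /RIII_swap => d; rewrite -/side.
case: (boolP (side d)) => dT.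
  have eT : side (edge D d) by rewrite side_edge.
  by rewrite side_oppN // oppK eT edgeK.
case: (boolP (side (opp d))) => oT; last by rewrite (negPf dT) (negPf oT).
by rewrite side_edge oT edgeK oppK.
Qed.

Variable s : dart D -> bool.
Hypothesis sA : alternating s.

(** On a segment p-[c]-q---q'-[c']-p' the passage through c is reversed iff c' is
non-self.  Before the move, the signs of p, q, q', p' are determined by that of p
and by which of c and c' are non-self.  After the move, p' is joined to p inside the
triangle and q' has taken over the place of p, so that the signs determined by that
of q' differ from the former ones exactly as described. *)
Definition RIII_flip d : bool :=
  side d && nonself (edge D d) || side (opp d) && nonself (edge D (opp d)).

Let flipped d := s d (+) RIII_flip d.

Lemma flip_opp d : RIII_flip (opp d) = RIII_flip d.
Proof. by rewrite /RIII_flip oppK orbC. Qed.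

Lemma flip_side d : side d -> RIII_flip d = nonself (edge D d).
Proof. by move=> dT; rewrite /RIII_flip dT side_oppN // orbF. Qed.

(** The correction added to [s d] is the same for the two ends of an edge, and
RIII joins the half-edges [swap d] and [swap (edge d)]: so the reversed sign changes
along every new edge. *)
Lemma flipped_swap d :
  flipped (swap d) = s d (+) (side d && (nonself d (+) nonself (edge D d))).
Proof.
rewrite /flipped /swap /RIII_swap -/side; case: (boolP (side d)) => dT /=.
  rewrite flip_opp flip_side ?side_edge // edgeK (sA _).2 (sA _).1.
  by case: (s d); case: nonself; case: nonself.
case: (boolP (side (opp d))) => oT; last first.
  by rewrite /RIII_flip (negPf dT) (negPf oT).
rewrite flip_side ?side_edge // edgeK nonself_opp (sA _).1 (sA _).2.
by case: (s d); case: nonself.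
Qed.

Lemma triangle_node x : node D (face D x) = edge D x.
Proof. by rewrite /face permM permKV. Qed.

(** The corners of the middle segment are those that it shares with the upper and
with the lower one. *)
Lemma triangle_alpha : nonself m && nonself (edge D m) -> RIII_alpha u m l.
Proof.
rewrite /nonself => /andP[/andP[_ mN] /andP[eX eN]].
have fm : comp (face D m) != comp m.
  by rewrite -(comp_edge m) /face permM comp_nodeV.
have vm x : face D x = m -> comp x != comp m.
  by move=> fx; move: mN; rewrite -fx triangle_node comp_edge.
rewrite /RIII_alpha; case: triangle_neighbours => -[E1 E2 E3].
  by rewrite (vm u) // -E2 eq_sym.
by rewrite -E3 fm eq_sym (vm l).
Qed.

(** The change of the summand of [d] under the reversal, for [d] on a side of the
triangle. *)
Let side_term (i : 'I_r) d : rat :=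
  if [&& comp d == i, nonself d & nonself (edge D d)]
  then - 2%:R * (-1) ^+ (s d (+) over d) else 0.

(** The reversals at the two half-edges [d] and [opp d] of a passage contribute
equally; the sum is over the half-edge on the side of the triangle. *)
Lemma flip_weight i : weight flipped i - weight s i =
  2%:R * \sum_(x <- [:: u; m; l]) (side_term i x + side_term i (edge D x)).
Proof.
have diff d : weight_at flipped i d - weight_at s i d =
    (if side d then side_term i d else 0)
    + (if side (opp d) then side_term i (opp d) else 0).
  have st e : side e -> weight_at flipped i e - weight_at s i e = side_term i e.
    move=> eT; rewrite /weight_at /flipped flip_side // /side_term.
    case: (comp e == i); case: (nonself e); rewrite /= ?subr0 //.
    by case: (nonself _); case: (s e); case: (over e); rewrite /= ?expr0 ?expr1; ring.
  case: (boolP (side d)) => dT; first by rewrite side_oppN // addr0 st.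
  case: (boolP (side (opp d))) => oT; rewrite add0r; last first.
    by rewrite /weight_at /flipped /RIII_flip (negPf dT) (negPf oT) addbF subrr.
  rewrite -(st _ oT) /weight_at comp_opp nonself_opp over_opp /flipped flip_opp (sA _).2.
  by case: (nonself d); rewrite ?andbF ?addbF.
rewrite !weight_sum -sumrB (eq_bigr _ (fun d _ => diff d)) big_split /=.
rewrite [X in _ + X](reindex_inj (inv_inj (@oppK r D))) /=.
under [X in _ + X]eq_bigr do rewrite oppK.
rewrite -mulr2n [RHS]mulr_natl; congr (_ *+ _).
rewrite (bigID (mem [:: u; m; l])) /= -(big_uniq _ uniq_triangle) big_split /=.
congr (_ + _).
  by rewrite big_seq [RHS]big_seq; apply: eq_bigr => x xT; rewrite /side /triangle_side xT.
rewrite (reindex_inj (inv_inj (@edgeK r D))) /= [LHS]big_mkcond [RHS](big_uniq _ uniq_triangle) /=.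
rewrite [RHS]big_mkcond; apply: eq_bigr => x _; rewrite side_edge.
case: (boolP (x \in [:: u; m; l])) => xT; last first.
  by case: ifP => // /negPf eT; rewrite /side /triangle_side (negPf xT) eT.
by rewrite edge_triangle // /side /triangle_side xT.
Qed.

(** The upper and the lower segment carry the same letter at both of their corners
and signs that differ, so their changes cancel. *)
Lemma flip_weight_bound i :
  `|weight flipped i - weight s i| <= if RIII_alpha u m l && (comp m == i) then 8%:R else 0.
Proof.
case: tri => _ _ [ou oeu] [ol oel] _.
have cancel x : over (edge D x) = over x -> side_term i x + side_term i (edge D x) = 0.
  move=> ox; rewrite /side_term comp_edge edgeK ox (sA x).1 [nonself _ && _ in X in _ + X]andbC.
  by case: ifP => _; rewrite ?addr0 // addNb signrN mulrN subrr.
rewrite flip_weight !big_cons big_nil (cancel u) ?(cancel l) ?ou ?oeu ?(negPf ol) ?(negPf oel) //.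
rewrite add0r !addr0 /side_term comp_edge edgeK [nonself (edge D m) && _]andbC.
case: (boolP (nonself m && nonself (edge D m))) => mN; last first.
  by rewrite !andbF addr0 mulr0 normr0; case: ifP.
rewrite triangle_alpha // andbT /=; case: ifP => _; last by rewrite addr0 mulr0 normr0.
by case: (s m (+) _); case: (s _ (+) _); rewrite /= ?expr0 ?expr1 ler_norml; lra.
Qed.

End Triangle.

(** The component [j] is the one of the middle segment; the bound 2 is the bound 8
for signed counts divided by 4. *)
Lemma OU_number_RIII r alpha (D D' : diagram r) : RIII_move alpha D D' ->
  exists j : 'I_r, forall i,
    `|OU_number D' i - OU_number D i| <= if alpha && (j == i) then 2%:R else 0.
Proof.
case=> f [u [m [l]]]; set swap := RIII_swap u m l.
case=> [[tri <-]] fP fe _ _; exists (comp m) => i.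
have [injf [uN fN] fc _ _] := fP.
have fsurj d' : exists d, f d = d'.
  by have /codomP[d ->] : d' \in codom f; [rewrite fN | exists d].
have [s sA] := ex_alternating D.
pose flipped d := s d (+) RIII_flip u m l d.
pose s' d' := [exists d, (f d == d') && flipped d].
have s'f d : s' (f d) = flipped d.
  apply/existsP/idP => [[e /andP[/eqP/injf->]]//|sd].
  by exists d; rewrite eqxx.
have vert d := agree_vertex (a := [::]) fP (fun=> erefl) (fun _ => ltac:(by [])) (isT : d \notin [::]).
have s'A : alternating s'.
  move=> d'; split.
    have [d0 <-] := fsurj d'; rewrite -(swapK tri d0) fe !s'f /flipped !(flipped_swap tri sA).
    rewrite (sA _).1 side_edge edgeK addNb [nonself (edge D _) (+) _]addbC.
    by [].
  have [d <-] := fsurj d'; have [_ -> -> _] := vert d.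
  by rewrite !s'f /flipped flip_opp (sA d).2 addbAC.
have ww : weight s' i = weight flipped i.
  rewrite !weight_sum (sum_embedding _ injf uN fN) big_nil addr0.
  by apply: eq_bigr => d _; have [_ _ ns os] := vert d; rewrite /weight_at fc ns os s'f.
rewrite (weight_OU i sA) (weight_OU i s'A) ww -mulrBl normrM normfV normr_nat ler_pdivrMr //.
have := flip_weight_bound tri sA i; rewrite -/flipped.
have := ler_dist_dist (weight flipped i) (weight s i).
case: ifP => _; rewrite ?mul0r; lra.
Qed.

(** * The lower bound *)

Lemma OU_variation_move r k (D D' : diagram r) : move k D D' ->
  \sum_(i < r) `|OU_number D' i - OU_number D i| <= (2 * is_RIIIalpha k)%:R.
Proof.
have inv : (forall i, OU_number D' i = OU_number D i) ->
    \sum_(i < r) `|OU_number D' i - OU_number D i| <= 0.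
  by move=> E; rewrite big1 // => i _; rewrite E subrr normr0.
case: k => [|||alpha] /=.
- by case=> [/OU_number_isotopic | /OU_number_subdivision]; apply: inv.
- by move/OU_number_RI; apply: inv.
- by move/OU_number_RII; apply: inv.
case/OU_number_RIII=> j jP; apply: le_trans (ler_sum _ (fun i _ => jP i)) _.
case: alpha {jP} => /=; last by rewrite big1.
by rewrite -big_mkcond /= (big_pred1 j) // => i; rewrite eq_sym.
Qed.

Lemma OU_variation_step r k (D D' : diagram r) : step k D D' ->
  \sum_(i < r) `|OU_number D' i - OU_number D i| <= (2 * is_RIIIalpha k)%:R.
Proof.
case=> /OU_variation_move //; congr (_ <= _).
by apply: eq_bigr => i _; rewrite distrC.
Qed.

Theorem theorem2 (r : nat) (D D' : diagram r) (s : seq move_kind)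
    (hs : transforms s D D') :
  2%:R^-1 * (\sum_(i < r) `|OU_number D' i - OU_number D i|)
    <= (count is_RIIIalpha s)%:R :> rat.
Proof.
rewrite ler_pdivrMl // -natrM.
elim: s D hs => [|k s IHs] D /= => [->|[D1 /OU_variation_step DD1 /IHs D1D']].
  by rewrite big1 // => i _; rewrite subrr normr0.
rewrite mulnDr natrD; apply: le_trans (lerD DD1 D1D').
rewrite -big_split /=; apply: ler_sum => i _.
by rewrite addrC; apply: ler_distD.
Qed.
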